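(* Let $\varepsilon\in(0,\tfrac12)$ be constant and let $k=k(n)$ satisfy $(2+\varepsilon)\log_2 n\le k\le n^{1/2-\varepsilon}$. If the quantum strong search planted-clique conjecture holds, then for every constant $c>0$ and every constant $\tau\in(0,1)$ no efficient quantum algorithm, given $G$ and $k$, prepares, to trace distance $\tau$ and with probability $\ge n^{-c}$ over $G\sim G(n,\tfrac12,k)$, the uniform simplex state $$|\psi_{k-2}\rangle\;\propto\;\sum_{\sigma\in X_{k-2}(G)}|\sigma\rangle .$$
   Context: Graphs are simple graphs on $[n]=\{1,\dots,n\}$. $G(n,\tfrac12)$ is the Erdős–Rényi distribution (each edge present independently with probability $\tfrac12$). $G(n,\tfrac12,k)$ is obtained by drawing $G_0\sim G(n,\tfrac12)$, choosing a uniformly random $k$-subset $S\subseteq[n]$ and adding every edge inside $S$. The clique complex $X(G)$ is the simplicial complex whose $d$-simplices are the $(d+1)$-cliques of $G$; $X_d(G)$ is its set of $d$-simplices. A $d$-simplex $\sigma$ is encoded as the computational basis state $|\sigma\rangle$ labelled by the corresponding $(d+1)$-subset of $[n]$. Trace distance is $\tfrac12\|\rho-\rho'\|_1$. Efficient means running in time $\mathrm{poly}(n)$. ''No algorithm achieves probability at least $q(n)$'' means that no algorithm achieves this for all sufficiently large $n$. Strong search planted-clique conjecture (quantum version): for all constants $\varepsilon>0$, $\alpha\in(0,\tfrac12)$ and $c>0$, every quantum polynomial-time algorithm fails to find a $k$-clique in $G\sim G(n,\tfrac12,k)$ with probability at least $1-n^{-c}$ (i.e. succeeds with probability at most $n^{-c}$),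 for all sufficiently large $n$ and all $k$ with $(2+\varepsilon)\log_2 n\le k\le n^{1/2-\alpha}$. *)

(* Defs.v *)
From HB Require Import structures.
From mathcomp Require Import classical_sets filter topology reals sequences exp.
From mathcomp Require Import all_boot all_order all_algebra.
From mathcomp Require Import complex.

Set Implicit Arguments.
Unset Strict Implicit.
Unset Printing Implicit Defensive.

Import Order.TTheory GRing.Theory Num.Theory.
Local Open Scope ring_scope.
Local Open Scope sesquilinear_scope.

(* The vertex set [n] is 'I_n; a simple graph is any set of 2-subsets.    *)
Definition edge (n : nat) := {e : {set 'I_n} | #|e| == 2%N}.
Definition graph (n : nat) := {set edge n}.

Definition adj n (G : graph n) (i j : 'I_n) : bool :=
  [exists e in G, val e == [set i; j]].

Definition is_clique n (G : graph n) (s : {set 'I_n}) : bool :=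
  [forall i in s, forall j in s, (i != j) ==> adj G i j].

Definition clique_complex n (G : graph n) : {set {set 'I_n}} :=
  [set s | (s != set0) && is_clique G s].

Definition simplices n (G : graph n) (d : nat) : {set {set 'I_n}} :=
  [set s in clique_complex G | #|s| == d.+1].

Definition ER_weight (F : numFieldType) n (p : F) (G : graph n) : F :=
  \prod_(e : edge n) (if e \in G then p else 1 - p).

Definition plant n (G0 : graph n) (S : {set 'I_n}) : graph n :=
  G0 :|: [set e : edge n | val e \subset S].

Definition planted_expectation (F : numFieldType) n (k : nat)
    (f : graph n -> F) : F :=
  \sum_(G0 : graph n) ER_weight 2^-1 G0 *
    \sum_(S : {set 'I_n} | #|S| == k) 'C(n, k)%:R^-1 * f (plant G0 S).

Definition planted_probability (F : numFieldType) n (k : nat)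
    (P : pred (graph n)) : F :=
  planted_expectation k (fun G => (P G)%:R).

(* A computational basis state is labelled by the set of qubits equal to  *)
(* 1, and a (possibly unnormalized) state is its family of amplitudes.    *)
Definition state (C : numClosedFieldType) (m : nat) :=
  {ffun {set 'I_m} -> C}.

Definition zero_ket (C : numClosedFieldType) m : state C m :=
  [ffun s : {set 'I_m} => (s == set0)%:R].

Definition flip m (q : 'I_m) (s : {set 'I_m}) : {set 'I_m} :=
  if q \in s then s :\ q else q |: s.

Definition pauliX (C : numClosedFieldType) m (q : 'I_m) (v : state C m) :
    state C m :=
  [ffun s : {set 'I_m} => v (flip q s)].

Definition hadamard (C : numClosedFieldType) m (q : 'I_m) (v : state C m) :
    state C m :=
  [ffun s : {set 'I_m} => (sqrtC 2)^-1 *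
     (if q \in s then v (s :\ q) - v s else v s + v (q |: s))].

(* diag(1, exp(i pi / 4)) *)
Definition phaseT (C : numClosedFieldType) m (q : 'I_m) (v : state C m) :
    state C m :=
  [ffun s : {set 'I_m} => (if q \in s then (1 + 'i) / sqrtC 2 else 1) * v s].

Definition cnot (C : numClosedFieldType) m (c t : 'I_m) (v : state C m) :
    state C m :=
  if c == t then v
  else [ffun s : {set 'I_m} => v (if c \in s then flip t s else s)].

Definition collapse (C : numClosedFieldType) m (q : 'I_m) (b : bool)
    (v : state C m) : state C m :=
  [ffun s : {set 'I_m} => if (q \in s) == b then v s else 0].

(* A quantum random access machine: a classical program (one finite text  *)
(* for all input sizes) which has read-only access to the input (n, k, G),*)
(* works on zero-initialized arrays of natural numbers, and drives a      *)
(* quantum register through Clifford+T gates and measurements in the      *)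
(* computational basis. Each instruction costs one step. Arithmetic is    *)
(* restricted to + and truncated -, so after t steps all numbers have     *)
(* O(t + log n) bits and unit cost agrees with bit cost up to a           *)
(* polynomial. Polynomial time on this machine is thus the usual quantum  *)
(* polynomial time (uniform Clifford+T circuit families, possibly with    *)
(* intermediate measurements).                                            *)

Inductive expr :=
| ELit of nat
| ESize                      (* n *)
| EParam                     (* k *)
| EAdj of expr & expr        (* 1 if the two vertices are adjacent in G *)
| EGet of nat & expr         (* EGet a e is the cell e of array a *)
| EAdd of expr & expr
| ESub of expr & expr.

Inductive gate := GateX | GateH | GateT.

Inductive cmd :=
| Skip
| Assign of nat & expr & expr    (* Assign a e1 e2: a[e1] := e2 *)
| Gate of gate & expr
| CNot of expr & expr
| Measure of expr & nat & expr   (* Measure q a e: a[e] := outcome at q *)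
| Seq of cmd & cmd
| If of expr & cmd & cmd         (* a nonzero value means true *)
| While of expr & cmd.

Definition store := nat -> nat -> nat.

Definition update (s : store) (a i x : nat) : store :=
  fun a' i' => if (a' == a) && (i' == i) then x else s a' i'.

Fixpoint eval n (k : nat) (G : graph n) (s : store) (e : expr) : nat :=
  match e with
  | ELit x => x
  | ESize => n
  | EParam => k
  | EAdj e1 e2 =>
      match insub (eval k G s e1), insub (eval k G s e2) with
      | Some i, Some j => adj G i j : nat
      | _, _ => 0%N
      end
  | EGet a e1 => s a (eval k G s e1)
  | EAdd e1 e2 => (eval k G s e1 + eval k G s e2)%N
  | ESub e1 e2 => (eval k G s e1 - eval k G s e2)%N
  end.

Definition apply_gate (C : numClosedFieldType) m (g : gate) :
    'I_m -> state C m -> state C m :=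
  match g with
  | GateX => @pauliX C m
  | GateH => @hadamard C m
  | GateT => @phaseT C m
  end.

(* A measurement branch: the instructions still to be executed, the       *)
(* memory, and the unnormalized state, whose squared norm is the          *)
(* probability of the branch.                                             *)
Record branch (C : numClosedFieldType) (m : nat) := Branch {
  todo : seq cmd;
  memory : store;
  ket : state C m }.

(* Gates on qubits outside the register have no effect, and measuring     *)
(* such a qubit returns 0.                                                *)
Definition step (C : numClosedFieldType) m n (k : nat) (G : graph n)
    (b : branch C m) : seq (branch C m) :=
  let: Branch p s v := b in
  let ev := eval k G s in
  match p with
  | [::] => [:: b]
  | Skip :: p' => [:: Branch p' s v]
  | Assign a e1 e2 :: p' => [:: Branch p' (update s a (ev e1) (ev e2)) v]
  | Gate g e :: p' =>
      [:: Branch p' s (if insub (ev e) is Some q then apply_gate g q v else v)]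
  | CNot e1 e2 :: p' =>
      [:: Branch p' s
            (match insub (ev e1), insub (ev e2) with
             | Some q1, Some q2 => cnot q1 q2 v
             | _, _ => v
             end)]
  | Measure e a e1 :: p' =>
      if insub (ev e) is Some q then
        [:: Branch p' (update s a (ev e1) 0%N) (collapse q false v);
            Branch p' (update s a (ev e1) 1%N) (collapse q true v)]
      else [:: Branch p' (update s a (ev e1) 0%N) v]
  | Seq c1 c2 :: p' => [:: Branch [:: c1, c2 & p'] s v]
  | If e c1 c2 :: p' =>
      [:: Branch ((if ev e != 0%N then c1 else c2) :: p') s v]
  | While e c :: p' =>
      [:: Branch (if ev e != 0%N then [:: c, While e c & p'] else p') s v]
  end.

Definition run (C : numClosedFieldType) (m n k : nat) (G : graph n) (p : cmd)
    (t : nat) : seq (branch C m) :=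
  iter t (fun bs => flatten [seq step k G b | b <- bs])
    [:: Branch [:: p] (fun _ _ => 0%N) (zero_ket C m)].

(* Branches of probability zero are exempted.                             *)
Definition halts (C : numClosedFieldType) (m n k : nat) (G : graph n) (p : cmd)
    (t : nat) : bool :=
  all (fun b => (ket b == 0) || nilp (todo b)) (run C m k G p t).

Definition poly_bound (d n : nat) : nat := (n ^ d + d)%N.

(* The register has n output qubits, one for each vertex, followed by     *)
(* polynomially many work qubits.                                         *)
Record qpoly_algorithm (C : numClosedFieldType) := QPolyAlgorithm {
  program : cmd;
  work_degree : nat;
  time_degree : nat;
  halts_in_time : forall (n k : nat) (G : graph n), (k <= n)%N ->
    halts C (n + poly_bound work_degree n) k G program
      (poly_bound time_degree n) }.

Definition split_label n w (s : {set 'I_n}) (t : {set 'I_w}) :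
    {set 'I_(n + w)} :=
  [set lshift w i | i in s] :|: [set rshift n j | j in t].

(* Operators on n qubits, with rows and columns labelled by the subsets   *)
(* of 'I_n through enum_rank.                                             *)
Definition operator (C : numClosedFieldType) n := 'M[C]_#|{: {set 'I_n}}|.

Definition operator_of (C : numClosedFieldType) n
    (f : {set 'I_n} -> {set 'I_n} -> C) : operator C n :=
  \matrix_(i, j) f (enum_val i) (enum_val j).

Definition entry (C : numClosedFieldType) n (M : operator C n)
    (s t : {set 'I_n}) : C := M (enum_rank s) (enum_rank t).

Definition projector (C : numClosedFieldType) n (v : state C n) :
    operator C n :=
  operator_of (fun s t => v s * (v t)^*).

Definition trace_out_work (C : numClosedFieldType) n w (v : state C (n + w)) :
    operator C n :=
  operator_of (fun s t =>
    \sum_(u : {set 'I_w}) v (split_label s u) * (v (split_label t u))^*).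

Definition output_state (C : numClosedFieldType) (A : qpoly_algorithm C)
    n (k : nat) (G : graph n) : operator C n :=
  let w := poly_bound (work_degree A) n in
  \sum_(b <- run C (n + w) k G (program A) (poly_bound (time_degree A) n))
    trace_out_work (ket b).

Definition trace_norm (C : numClosedFieldType) m (M : 'M[C]_m) : C :=
  \sum_i sqrtC (spectral_diag (M^t* *m M) 0 i).

Definition trace_distance (C : numClosedFieldType) n (M N : operator C n) : C :=
  2^-1 * trace_norm (M - N).

Definition simplex_state (C : numClosedFieldType) n (G : graph n) (d : nat) :
    state C n :=
  [ffun s : {set 'I_n} => if s \in simplices G d then (sqrtC #|simplices G d|%:R)^-1
             else 0].

(* A classical answer is read by measuring the output qubits in the       *)
(* computational basis. The diagonal entries are nonnegative reals.       *)
Definition search_success (R : realType) (A : qpoly_algorithm R[i])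
    (n k : nat) : R :=
  planted_expectation k (fun G : graph n =>
    \sum_(s : {set 'I_n} | is_clique G s && (#|s| == k))
      complex.Re (entry (output_state A k G) s s)).

Definition log2 (R : realType) (x : R) : R := ln x / ln 2.

Definition quantum_strong_search_conjecture (R : realType) : Prop :=
  forall eps alpha c : R, 0 < eps -> 0 < alpha < 2^-1 -> 0 < c ->
  forall A : qpoly_algorithm R[i],
  \forall n \near \oo%classic, forall k : nat,
    (2 + eps) * log2 n%:R <= k%:R <= n%:R `^ (2^-1 - alpha) ->
    search_success A n k <= n%:R `^ (- c).

(* Main.v *)
(* Measuring a state close to the uniform simplex state yields a (k-1)-clique T
   with probability at least 1 - tau. A first-moment bound shows that, except
   with probability n^-c / 2, every (k-1)-clique of the planted graph has at
   most L = O(1) vertices outside the planted clique S, so T differs from S in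
   at most 2 L + 1 vertices. Flipping 2 L + 1 uniformly random output qubits therefore
   turns T into S with probability at least n^-O(1), and this polynomially small
   success probability contradicts the conjecture, whose exponent is arbitrary.

   The register of the given algorithm must not be enlarged, because gates on
   missing qubits are ignored and its behaviour could change; fair coins are
   instead obtained by recycling one of its work qubits. *)

Require Import Defs.
From mathcomp Require Import classical_sets filter topology reals sequences exp.
From mathcomp Require Import all_boot all_order all_algebra.
From mathcomp Require Import complex ring lra zify.

Set Implicit Arguments.
Unset Strict Implicit.
Unset Printing Implicit Defensive.

Import Order.TTheory GRing.Theory Num.Theory.
Local Open Scope ring_scope.
Local Open Scope sesquilinear_scope.

(** * Trace distance and measurement *)

(** Rotate by the unitary [P] that diagonalizes [M^t* *m M]. The trace becomes a sum of inner
    products of the rows of [P *m Q], which are unit vectors, with the rows of [P *m M^t*], whose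
    squared norms are the eigenvalues; Cauchy-Schwarz bounds each term. *)
Lemma norm_tr_unitary_le (C : numClosedFieldType) m (Q M : 'M[C]_m) :
  Q \is unitarymx -> `|\tr (Q *m M)| <= trace_norm M.
Proof.
move=> Qu; rewrite /trace_norm; set N := M^t* *m M.
have Pu : spectralmx N \is unitarymx := spectral_unitarymx N.
have Nn : N \is normalmx.
  suff NN : N^t* = N by apply/normalmxP; rewrite NN.
  by rewrite /N trmx_mul map_mxM /= trmxCK.
have NE : spectralmx N *m N *m (spectralmx N)^t* = diag_mx (spectral_diag N).
  rewrite {2}(orthomx_spectralP Nn) !mulmxA mulmxV ?unitarymx_unit // mul1mx.
  by rewrite mulmxtVK.
set P := spectralmx N in Pu NE.
have -> : \tr (Q *m M) = \tr ((P *m Q) *m (P *m M^t*)^t*).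
  rewrite trmx_mul map_mxM /= trmxCK mxtrace_mulC !mulmxA.
  rewrite [in RHS]mxtrace_mulC !mulmxA -invmx_unitary //.
  by rewrite mulVmx ?unitarymx_unit // mul1mx mxtrace_mulC.
apply: le_trans (ler_norm_sum _ _ _) _; apply: ler_sum => i _.
have -> : ((P *m Q) *m (P *m M^t*)^t*) i i
    = dotmx (row i (P *m Q)) (row i (P *m M^t*)).
  by rewrite dotmxE !mxE; apply: eq_bigr => j _; rewrite !mxE.
have CS (u v : 'rV[C]_m) :
    `|dotmx u v| <= sqrtC (dotmx u u) * sqrtC (dotmx v v).
  by case: (CauchySchwarz_sqrt (@dotmx C m) u v).
apply: le_trans (CS _ _) _.
have /row_unitarymxP -> : P *m Q \is unitarymx by exact: mul_unitarymx.
rewrite eqxx sqrtC1 mul1r.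
have -> // : dotmx (row i (P *m M^t*)) (row i (P *m M^t*))
    = spectral_diag N 0 i.
have := congr1 (fun A : 'M_m => A i i) NE.
rewrite [X in _ = X]mxE eqxx mulr1n => <-.
have ME : M *m P^t* = (P *m M^t*)^t* by rewrite trmx_mul map_mxM /= trmxCK.
rewrite dotmxE mulmxA -mulmxA ME mxE [in RHS]mxE.
by apply: eq_bigr => j _; rewrite !mxE.
Qed.

Lemma entry_operator_of (C : numClosedFieldType) n
    (f : {set 'I_n} -> {set 'I_n} -> C) s t :
  entry (operator_of f) s t = f s t.
Proof. by rewrite /entry mxE !enum_rankK. Qed.

(* Testing with the projector P on A would only bound the loss by
   [2 * tau]; the reflection 1 - 2 P gains the factor 1/2. *)
Lemma measure_trace_distance (C : numClosedFieldType) n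
    (rho sigma : operator C n) (A : {set {set 'I_n}}) (tau : C) :
    \sum_s entry rho s s = 1 ->
    \sum_(s in A) entry rho s s \is Num.real ->
    \sum_(s in A) entry sigma s s = 1 ->
    (forall s, s \notin A -> entry sigma s s = 0) ->
    trace_distance rho sigma <= tau ->
  1 - tau <= \sum_(s in A) entry rho s s.
Proof.
move=> rho1 rhoA sigmaA sigma0 dist.
pose q s : C := if s \in A then -1 else 1.
pose Q : operator C n := diag_mx (\row_i q (enum_val i)).
have Qu : Q \is unitarymx.
  apply/unitarymxP; rewrite tr_diag_mx map_diag_mx mulmx_diag -diag_const_mx.
  congr diag_mx; apply/rowP => i; rewrite !mxE /q.
  by case: ifP => _; rewrite ?rmorphN1 ?rmorph1 ?mulrNN mulr1.
have trE : \tr (Q *m (rho - sigma))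
    = \sum_s q s * (entry rho s s - entry sigma s s).
  rewrite /mxtrace (reindex (@enum_rank {set 'I_n})) /=; last first.
    by exists enum_val => i _; [exact: enum_rankK | exact: enum_valK].
  by apply: eq_bigr => s _; rewrite mul_diag_mx !mxE enum_rankK.
(* Inside [A] the signs give 1 minus the weight of [rho] on [A]. Outside [A], where [sigma]
   vanishes, they give the remaining trace of [rho], which is the same number. *)
have trp : \tr (Q *m (rho - sigma))
    = (1 - \sum_(s in A) entry rho s s) *+ 2.
  rewrite trE (bigID (mem A)) /= (eq_bigr (fun s =>
    entry sigma s s - entry rho s s)); last first.
    by move=> s sA; rewrite /q sA mulN1r opprB.
  rewrite sumrB sigmaA (eq_bigr (fun s => entry rho s s)); last first.
    by move=> s sA; rewrite /q (negPf sA) mul1r sigma0 // subr0.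
  rewrite mulr2n; congr (_ + _).
  rewrite -[in RHS]rho1 [in RHS](bigID (mem A)) /=.
  by rewrite addrAC subrr add0r.
(* The order on [C] is partial, so a number is compared with its norm only once it is known to be
   real. *)
rewrite lerBlDr addrC -lerBlDr; apply: real_ler_normlW.
  by rewrite rpredB ?real1.
apply: le_trans dist; rewrite /trace_distance ler_pdivlMl ?ltr0n //.
apply: le_trans (norm_tr_unitary_le _ Qu); rewrite trp normrMn.
by rewrite mulr_natl.
Qed.

(** * Quantum programs *)

Lemma in_flip m (q x : 'I_m) (s : {set 'I_m}) :
  (x \in flip q s) = (x \in s) (+) (x == q).
Proof.
rewrite /flip; case: ifP => qs; rewrite !inE; case: eqVneq => [->|_] //=.
- by rewrite qs.
- by rewrite addbF.
- by rewrite qs.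
- by rewrite addbF.
Qed.

Lemma flipK m (q : 'I_m) : involutive (flip q).
Proof. by move=> s; apply/setP=> x; rewrite !in_flip addbK. Qed.

(** [flip q] pairs the sets containing [q] with those avoiding it, and [b] selects one
    representative of each pair. *)
Lemma sum_flip (V : nmodType) m (q : 'I_m) (b : bool) (g : {set 'I_m} -> V) :
  \sum_(s : {set _} | (q \in s) == b) (g s + g (flip q s)) = \sum_s g s.
Proof.
rewrite big_split [RHS](bigID (fun s : {set _} => (q \in s) == b)) /=.
congr (_ + _).
rewrite [RHS](reindex_inj (inv_inj (flipK q))) /=.
by apply: eq_bigl => s; rewrite in_flip eqxx; case: (q \in s) b => -[].
Qed.

Section Amplitudes.
Variables (C : numClosedFieldType) (m : nat).
Implicit Types (v : state C m) (q : 'I_m) (s : {set 'I_m}).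

Definition sqnorm v : C := \sum_s `|v s| ^+ 2.

Lemma hadamardE q v s : hadamard q v s =
  (sqrtC 2)^-1 * (v (flip q s) + (-1) ^+ (q \in s) * v s).
Proof.
rewrite ffunE /flip; case: ifP => _; first by rewrite expr1 mulN1r.
by rewrite expr0 mul1r addrC.
Qed.

Lemma sqnorm_sqrt2V (x : C) : `|(sqrtC 2)^-1 * x| ^+ 2 = 2^-1 * `|x| ^+ 2.
Proof.
rewrite normrM exprMn normfV [`|sqrtC _|]ger0_norm ?sqrtC_ge0 ?ler0n //.
by rewrite exprVn sqrtCK.
Qed.

Lemma parallelogram (x y : C) :
  `|x + y| ^+ 2 + `|x - y| ^+ 2 = 2 * (`|x| ^+ 2 + `|y| ^+ 2).
Proof.
rewrite !normCK rmorphD rmorphB mulrBl !mulrDl !mulrDr !mulrN; ring.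
Qed.

(** On a pair [s], [flip q s] the gate forms the sum and the difference of two amplitudes, divided
    by the square root of 2; this is the parallelogram law. *)
Lemma sqnorm_hadamard q v : sqnorm (hadamard q v) = sqnorm v.
Proof.
rewrite /sqnorm -(sum_flip q true) -[RHS](sum_flip q true).
apply: eq_bigr => s /eqP qs; rewrite !hadamardE flipK in_flip eqxx qs /=.
rewrite !sqnorm_sqrt2V expr1 expr0 mulN1r mul1r -mulrDr [v s + _]addrC.
by rewrite [X in _ * X]addrC parallelogram mulKf ?pnatr_eq0 // addrC.
Qed.

Lemma sqnorm_pauliX q v : sqnorm (pauliX q v) = sqnorm v.
Proof.
rewrite /sqnorm [RHS](reindex_inj (inv_inj (flipK q))).
by apply: eq_bigr => s _; rewrite ffunE.
Qed.

Lemma sqnorm_phaseT q v : sqnorm (phaseT q v) = sqnorm v.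
Proof.
have phase1 : `|(1 + 'i) / sqrtC 2 : C| ^+ 2 = 1.
  rewrite mulrC sqnorm_sqrt2V -['i]mulr1 normC2_rect ?real1 //.
  by rewrite expr1n mulVf // pnatr_eq0.
apply: eq_bigr => s _; rewrite ffunE; case: ifP => _; last by rewrite mul1r.
by rewrite normrM exprMn phase1 mul1r.
Qed.

Lemma sqnorm_cnot q t v : sqnorm (cnot q t v) = sqnorm v.
Proof.
rewrite /cnot; case: eqVneq => // qt.
(* As control and target differ, flipping the target keeps the control bit, so the relabelling
   undoes itself. *)
have K : involutive (fun s => if q \in s then flip t s else s).
  move=> s; case: (boolP (q \in s)) => qs; last by rewrite (negPf qs).
  by rewrite in_flip qs (negPf qt) /= flipK.
rewrite /sqnorm [RHS](reindex_inj (inv_inj K)).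
by apply: eq_bigr => s _; rewrite ffunE.
Qed.

Lemma sqnorm_collapse q v :
  sqnorm (collapse q false v) + sqnorm (collapse q true v) = sqnorm v.
Proof.
rewrite /sqnorm -big_split; apply: eq_bigr => s _ /=; rewrite !ffunE.
by case: (q \in s); rewrite normr0 expr0n ?addr0 ?add0r.
Qed.

Lemma sqnorm_zero_ket : sqnorm (zero_ket C m) = 1.
Proof.
rewrite /sqnorm (bigD1 set0) //= big1 => [|s /negPf s0]; rewrite ffunE.
  by rewrite eqxx normr1 expr1n addr0.
by rewrite s0 normr0 expr0n.
Qed.

End Amplitudes.

Section OutputWeight.
Variables (C : numClosedFieldType) (n w : nat).
Implicit Types (v : state C (n + w)) (s : {set 'I_n}) (u : {set 'I_w}).

(** The probability, not normalized, that measuring the output qubits yields [s]: a diagonal entry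
    of the reduced state. *)
Definition output_weight v s : C := \sum_u `|v (split_label s u)| ^+ 2.

Lemma output_weight_ge0 v s : 0 <= output_weight v s.
Proof. by apply: sumr_ge0 => u _; rewrite exprn_ge0. Qed.

Lemma output_weight0 s : output_weight 0 s = 0.
Proof. by apply: big1 => u _; rewrite ffunE normr0 expr0n. Qed.

Lemma entry_trace_out_work v s :
  entry (trace_out_work v) s s = output_weight v s.
Proof. by rewrite entry_operator_of; apply: eq_bigr => u _; rewrite normCK. Qed.

Lemma lshift_split_label s u i : (lshift w i \in split_label s u) = (i \in s).
Proof.
rewrite inE mem_imset; last exact: lshift_inj.
by case: imsetP => [[j _ /eqP]|_]; rewrite ?eq_lrshift // orbF.
Qed.

Lemma rshift_split_label s u j : (rshift n j \in split_label s u) = (j \in u).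
Proof.
rewrite inE orbC mem_imset; last exact: rshift_inj.
by case: imsetP => [[i _ /eqP]|_]; rewrite ?eq_rlshift // orbF.
Qed.

Lemma flip_lshift s u i :
  flip (lshift w i) (split_label s u) = split_label (flip i s) u.
Proof.
apply/setP=> x; rewrite in_flip; case: (split_ordP x) => j ->.
  by rewrite !lshift_split_label in_flip (inj_eq (@lshift_inj _ _)).
by rewrite !rshift_split_label eq_rlshift addbF.
Qed.

Lemma flip_rshift s u j :
  flip (rshift n j) (split_label s u) = split_label s (flip j u).
Proof.
apply/setP=> x; rewrite in_flip; case: (split_ordP x) => i ->.
  by rewrite !lshift_split_label eq_lrshift addbF.
by rewrite !rshift_split_label in_flip (inj_eq (@rshift_inj _ _)).
Qed.

Lemma sum_output_weight v : \sum_s output_weight v s = sqnorm v.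
Proof.
rewrite pair_big /= /sqnorm.
rewrite (reindex (fun x : {set 'I_n} * {set 'I_w} => split_label x.1 x.2)) //.
exists (fun x : {set _} =>
  ([set i | lshift w i \in x], [set j | rshift n j \in x])).
  move=> [s u] _ /=; congr (_, _); apply/setP => i; rewrite inE.
    exact: lshift_split_label.
  exact: rshift_split_label.
move=> x _; apply/setP => i; case: (split_ordP i) => j -> /=.
  by rewrite lshift_split_label inE.
by rewrite rshift_split_label inE.
Qed.

(* Measuring a work qubit, applying H and measuring again yields a fair coin
   that is independent of the output qubits, whatever the state was. *)
Lemma output_weight_coin v s (j : 'I_w) (c : bool) :
  \sum_(b : bool)
     output_weight (collapse (rshift n j) c
       (hadamard (rshift n j) (collapse (rshift n j) b v))) s
  = 2^-1 * output_weight v s.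
Proof.
pose q := rshift n j.
(* After the first measurement at most one of [u], [flip j u] carries amplitude. The gate spreads it
   evenly over both coin values, and [b] affects only a sign. *)
have half b : output_weight (collapse q c (hadamard q (collapse q b v))) s
    = 2^-1 * output_weight (collapse q b v) s.
  rewrite /output_weight -[in RHS](sum_flip j c) mulr_sumr [RHS]big_mkcond /=.
  apply: eq_bigr => u _; rewrite [collapse q c _ _]ffunE rshift_split_label.
  case: ifP => _; last by rewrite normr0 expr0n.
  rewrite hadamardE sqnorm_sqrt2V /q flip_rshift; congr (_ * _).
  rewrite !ffunE !rshift_split_label in_flip eqxx addbT.
  case: (j \in u); case: b => /=;
    by rewrite ?mulr0 ?add0r ?addr0 ?normr0 ?expr0n ?add0r ?addr0 // normrMsign.
under eq_bigr => b _ do rewrite half.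
rewrite -mulr_sumr exchange_big /=; congr (_ * _); apply: eq_bigr => u _.
rewrite big_bool !ffunE rshift_split_label.
by case: (j \in u); rewrite /= normr0 expr0n ?addr0 ?add0r.
Qed.

(** A randomly drawn index may miss the output register; the measured set is then unchanged. *)
Definition flip_nat (r : nat) s : {set 'I_n} :=
  if insub r is Some i then flip i s else s.

(** Flipping an output qubit relabels [s], flipping a work qubit only permutes the terms of the sum
    over [u], and a missing qubit is ignored. *)
Lemma output_weight_pauliX v s (r : nat) :
  output_weight (if insub r is Some q then pauliX q v else v) s
  = output_weight v (flip_nat r s).
Proof.
rewrite /flip_nat; case: insubP => [q _ <-|]; last first.
  by case: insubP => // i ri _ /negP[]; rewrite ltn_addr.
case: (split_ordP q) => i ->.
  rewrite (_ : val (lshift w i) = val i) // valK.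
  by apply: eq_bigr => u _; rewrite ffunE flip_lshift.
rewrite insubF; last by rewrite /= ltnNge leq_addr.
rewrite [RHS](reindex_inj (inv_inj (flipK i))).
by apply: eq_bigr => u _; rewrite ffunE flip_rshift.
Qed.

End OutputWeight.

(** Branches carry unnormalized states, so for [f] quadratic in the ket the plain sum already is the
    expectation over measurement outcomes. *)
Definition expectation (C : numClosedFieldType) (m n k : nat) (G : graph n) t
    (f : branch C m -> C) (bs : seq (branch C m)) : C :=
  \sum_(b <- iter t (fun bs => flatten [seq step k G b | b <- bs]) bs) f b.

Section Expectation.
Variables (C : numClosedFieldType) (m n k : nat) (G : graph n).
Implicit Types (b : branch C m) (f g : branch C m -> C) (bs : seq (branch C m)).

Local Notation expect := (@expectation C m n k G).

Lemma expectation_cat t f bs1 bs2 :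
  expect t f (bs1 ++ bs2) = expect t f bs1 + expect t f bs2.
Proof.
rewrite /expectation; set F := (fun bs => flatten _).
suff -> : iter t F (bs1 ++ bs2) = iter t F bs1 ++ iter t F bs2.
  by rewrite big_cat.
by elim: t => //= t ->; rewrite /F map_cat flatten_cat.
Qed.

Lemma expectationE t f bs : expect t f bs = \sum_(b <- bs) expect t f [:: b].
Proof.
elim: bs => [|b bs IH]; last by rewrite -cat1s expectation_cat IH big_cons.
rewrite /expectation big_nil; set F := (fun bs => flatten _).
suff -> : iter t F [::] = [::] by rewrite big_nil.
by elim: t => //= t ->.
Qed.

Lemma expectation0 f b : expect 0 f [:: b] = f b.
Proof. by rewrite /expectation /= big_seq1. Qed.

Lemma expectationS t f b :
  expect t.+1 f [:: b] = \sum_(b' <- step k G b) expect t f [:: b'].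
Proof. by rewrite -expectationE /expectation iterSr /= cats0. Qed.

Lemma expectationD t1 t2 f b :
  expect (t1 + t2) f [:: b] = expect t1 (fun b' => expect t2 f [:: b']) [:: b].
Proof. by rewrite {2}/expectation -expectationE /expectation addnC iterD. Qed.

Lemma sqnorm_step b : \sum_(b' <- step k G b) sqnorm (ket b') = sqnorm (ket b).
Proof.
case: b => [[|c p] s v] /=; first by rewrite big_seq1.
case: c => [|a e1 e2|g e|e1 e2|e a e1|c1 c2|e c1 c2|e c] /=;
  rewrite ?big_seq1 //.
- case: insub => //= q.
  by case: g; rewrite /= (sqnorm_pauliX, sqnorm_hadamard, sqnorm_phaseT).
- by case: insub => //= q1; case: insub => //= q2; rewrite sqnorm_cnot.
- case: insub => [q|]; rewrite ?big_seq1 // !big_cons big_nil addr0.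
  exact: sqnorm_collapse.
Qed.

Lemma expectation_sqnorm t b :
  expect t (fun b => sqnorm (ket b)) [:: b] = sqnorm (ket b).
Proof.
elim: t b => [|t IH] b; first exact: expectation0.
rewrite expectationS -[RHS]sqnorm_step.
by apply: eq_bigr => b' _; exact: IH.
Qed.

(** Every instruction acts linearly on the ket. Hence branches of probability zero, which are exempt
    from halting, never contribute later. *)
Lemma step_ket0 b : ket b = 0 -> all (fun b' => ket b' == 0) (step k G b).
Proof.
case: b => [[|c p] s v] /= ->; first by rewrite eqxx.
have pauliX0 q : pauliX q (0 : state C m) = 0.
  by apply/ffunP=> x; rewrite !ffunE.
have hadamard0 q : hadamard q (0 : state C m) = 0.
  by apply/ffunP=> x; rewrite !ffunE subrr addr0 if_same mulr0.
have phaseT0 q : phaseT q (0 : state C m) = 0.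
  by apply/ffunP=> x; rewrite !ffunE mulr0.
have cnot0 q1 q2 : cnot q1 q2 (0 : state C m) = 0.
  by rewrite /cnot; case: eqP => // _; apply/ffunP=> x; rewrite !ffunE.
have collapse0 q d : collapse q d (0 : state C m) = 0.
  by apply/ffunP=> x; rewrite !ffunE if_same.
case: c => [|a e1 e2|g e|e1 e2|e a e1|c1 c2|e c1 c2|e c] /=; rewrite ?eqxx //.
- case: insub => [q|]; rewrite ?eqxx // andbT.
  by case: g; rewrite /= (pauliX0, hadamard0, phaseT0).
- by case: insub => [q1|]; last rewrite eqxx //; case: insub => [q2|];
    rewrite ?cnot0 eqxx.
- by case: insub => [q|]; rewrite /= ?collapse0 ?eqxx.
Qed.

Lemma expectation_ket0 t f b : (forall b', ket b' = 0 -> f b' = 0) ->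
  ket b = 0 -> expect t f [:: b] = 0.
Proof.
move=> f0; elim: t b => [|t IH] b b0; first by rewrite expectation0 f0.
rewrite expectationS; elim: (step k G b) (step_ket0 b0) => [|b' bs IHbs] /=.
  by rewrite big_nil.
by move=> /andP[/eqP b'0 bs0]; rewrite big_cons IHbs // IH // addr0.
Qed.

Lemma expectation_idle t f s v :
  expect t f [:: Branch [::] s v] = f (Branch [::] s v).
Proof.
elim: t => [|t IH]; first exact: expectation0.
by rewrite expectationS /= big_seq1.
Qed.

Definition with_suffix (p : seq cmd) b : branch C m :=
  Branch (todo b ++ p) (memory b) (ket b).

Lemma step_suffix p b : ~~ nilp (todo b) ->
  step k G (with_suffix p b) = [seq with_suffix p b' | b' <- step k G b].
Proof.
case: b => [[|c q] s v] //= _.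
case: c => [|a e1 e2|g e|e1 e2|e a e1|c1 c2|e c1 c2|e c] //=.
- by case: insub.
- by case: ifP.
Qed.

(* The branches of the first program may halt at different times and those of
   probability zero need not halt at all. *)
Lemma expectation_suffix t1 t2 p f b :
    (forall b', ket b' = 0 -> f b' = 0) ->
    (forall s v u, expect (t2 + u) f [:: Branch p s v] =
                   expect t2 f [:: Branch p s v]) ->
    all (fun b' => (ket b' == 0) || nilp (todo b'))
      (iter t1 (fun bs => flatten [seq step k G b | b <- bs]) [:: b]) ->
  expect (t1 + t2) f [:: with_suffix p b]
  = expect t1 (fun b' => expect t2 f [:: Branch p (memory b') (ket b')]) [:: b].
Proof.
move=> f0 idle; elim: t1 b => [|t1 IH] b.
  rewrite /= andbT add0n expectation0; case: b => [q s v] /=.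
  by case/orP => [/eqP ->|/nilP ->]; rewrite // !expectation_ket0.
(* A branch whose first program has ended enters the suffix early; by [idle] the surplus steps are
   harmless. *)
have [/nilP b0 _|bN0] := boolP (nilp (todo b)).
  case: b b0 => [q s v] /= ->; rewrite expectation_idle /=.
  by rewrite /with_suffix /= addnC idle.
rewrite iterSr /= cats0 => halt; rewrite addSn !expectationS step_suffix //.
rewrite big_map; elim: (step k G b) halt => [|b' bs IHbs]; rewrite ?big_nil //.
set F := (fun bs => flatten _).
have -> : iter t1 F (b' :: bs) = iter t1 F [:: b'] ++ iter t1 F bs.
  rewrite -cat1s; elim: (t1) [:: b'] => //= t IHt x.
  by rewrite IHt /F map_cat flatten_cat.
by rewrite all_cat !big_cons => /andP[/IH -> /IHbs ->].
Qed.

End Expectation.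

(** * Random flips of output qubits *)

Local Notation index_cell := (EGet 0 (ELit 0)).
Local Notation range_cell := (EGet 1 (ELit 0)).
Local Notation coin_cell := (EGet 2 (ELit 0)).

(* The qubit with index n is the first work qubit. *)
Definition toss_coin : cmd :=
  Seq (Measure ESize 2 (ELit 0))
    (Seq (Gate GateH ESize) (Measure ESize 2 (ELit 0))).

(* Appends fair bits to the index until it is uniform below the least power
   of 2 exceeding n. *)
Definition draw_index : cmd :=
  While (ESub (EAdd ESize (ELit 1)) range_cell)
    (Seq toss_coin
      (Seq (Assign 0 (ELit 0) (EAdd (EAdd index_cell index_cell) coin_cell))
           (Assign 1 (ELit 0) (EAdd range_cell range_cell)))).

(** Index and range are reset first, because the memory still holds values left by the given
    algorithm or by the previous flip. *)
Definition random_flip : cmd :=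
  Seq (Assign 0 (ELit 0) (ELit 0))
    (Seq (Assign 1 (ELit 0) (ELit 1))
      (Seq draw_index (Gate GateX index_cell))).

Fixpoint random_flips (M : nat) : cmd :=
  if M is M'.+1 then Seq random_flip (random_flips M') else Skip.

Definition index_bits n := up_log 2 n.+1.

Lemma ltn_index_bits n : (n < 2 ^ index_bits n)%N.
Proof. exact: up_logP. Qed.

Lemma expn_index_bits n i : (i < index_bits n)%N -> (2 ^ i <= n)%N.
Proof.
move=> iJ; rewrite leqNgt; apply: contraL iJ => ni.
by rewrite -leqNgt; apply: up_log_min.
Qed.

Definition symdiff (T : finType) (s t : {set T}) : {set T} :=
  [set x | (x \in s) (+) (x \in t)].

Lemma symdiff_flip m (i : 'I_m) (s t : {set 'I_m}) :
  symdiff (flip i s) t = flip i (symdiff s t).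
Proof. by apply/setP=> x; rewrite !(inE, in_flip) addbAC. Qed.

Lemma flip_natK n r : involutive (@flip_nat n r).
Proof. by move=> s; rewrite /flip_nat; case: insub => // i; rewrite flipK. Qed.

(** Flip any vertex where the two sets differ. If there is none, take [r = n]: this index names no
    output qubit, so equal sets stay equal. At most, rather than exactly, [M.+1] differences can
    thus be repaired. *)
Lemma flip_nat_closer n (s t : {set 'I_n}) (M : nat) :
  (#|symdiff s t| <= M.+1)%N ->
  exists2 r : nat, (r <= n)%N & (#|symdiff (flip_nat r s) t| <= M)%N.
Proof.
move=> le_st; have [st0|[i ist]] := set_0Vmem (symdiff s t).
  by exists n => //; rewrite /flip_nat insubF ?ltnn // st0 cards0.
exists i; first exact: ltnW.
rewrite /flip_nat valK symdiff_flip /flip ist.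
by move: le_st; rewrite (cardsD1 i) ist.
Qed.

Section RandomFlips.
Variables (C : numClosedFieldType) (n w k : nat) (G : graph n).
Hypothesis w_gt0 : (0 < w)%N.

Local Notation expect := (@expectation C (n + w) n k G).
Local Notation J := (index_bits n).

Let q : 'I_(n + w) := rshift n (Ordinal w_gt0).

Let insub_q : insub n = Some q.
Proof. by rewrite -(valK q) /= addn0. Qed.

(** Two [Seq], two measurements and one gate make five steps; [b] is the overwritten first outcome
    and [c] the coin. *)
Lemma expect_toss_coin t f p s v :
  expect t.+4.+1 f [:: Branch (toss_coin :: p) s v]
  = \sum_(b : bool) \sum_(c : bool)
      expect t f [:: Branch p (update (update s 2 0 b) 2 0 c)
        (collapse q c (hadamard q (collapse q b v)))].
Proof.
do 8![rewrite expectationS /= ?insub_q !(big_cons, big_nil, addr0)].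
by rewrite big_bool /= !big_bool /= addrC; congr (_ + _); rewrite addrC.
Qed.

(** Induction on the number [d] of bits still to be drawn: the next coin selects one half of the
    interval of possible final indices, and [hcoin] supplies the factor 1/2. A round takes ten
    steps, and leaving the loop takes one more. *)
Lemma expect_draw_index (h : nat -> state C (n + w) -> C) p g :
    (forall r c v, \sum_(b : bool)
       h r (collapse q c (hadamard q (collapse q b v))) = 2^-1 * h r v) ->
    (forall s v, h (s 0 0)%N v <= g (Branch p s v)) ->
  forall d s v, (d <= J)%N -> s 1%N 0%N = (2 ^ (J - d))%N ->
  2^-1 ^+ d * \sum_(t < 2 ^ d) h (s 0 0 * 2 ^ d + t)%N v
    <= expect (10 * d).+1 g [:: Branch (draw_index :: p) s v].
Proof.
move=> hcoin gh; elim=> [|d IH] s v dJ range.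
  rewrite muln0 expectationS /= range subn0 big_seq1.
  have -> : (n + 1 - 2 ^ J)%N = 0%N.
    by apply/eqP; rewrite subn_eq0 addn1 ltn_index_bits.
  by rewrite expectation0 expr0 mul1r expn0 big_ord1 muln1 addn0 gh.
have cont : (n + 1 - s 1 0 != 0)%N.
  rewrite range subn_eq0 addn1 -ltnNge ltnS expn_index_bits //.
  by rewrite ltn_subrL (leq_trans _ dJ).
have -> : (10 * d.+1).+1 = (10 * d).+1.+4.+4.+2 by lia.
rewrite expectationS /= cont big_seq1 -/draw_index.
rewrite expectationS /= big_seq1 expect_toss_coin exchange_big /=.
have -> : \sum_(t < 2 ^ d.+1) h (s 0 0 * 2 ^ d.+1 + t)%N v
    = \sum_(c : bool) \sum_(t < 2 ^ d) h ((s 0 0 + s 0 0 + c) * 2 ^ d + t)%N v.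
  rewrite expnS mul2n -addnn big_split_ord big_bool /= addrC.
  by congr (_ + _); apply: eq_bigr => t _; congr h; lia.
rewrite mulr_sumr; apply: ler_sum => c _.
have -> : 2^-1 ^+ d.+1 *
      \sum_(t < 2 ^ d) h ((s 0 0 + s 0 0 + c) * 2 ^ d + t)%N v
    = \sum_(b : bool) 2^-1 ^+ d * \sum_(t < 2 ^ d)
        h ((s 0 0 + s 0 0 + c) * 2 ^ d + t)%N
          (collapse q c (hadamard q (collapse q b v))).
  rewrite -mulr_sumr exchange_big /= exprSr -mulrA; congr (_ * _).
  by rewrite mulr_sumr; apply: eq_bigr => t _; rewrite hcoin.
apply: ler_sum => b _; do 3![rewrite expectationS /= big_seq1].
apply: le_trans (IH _ _ (ltnW dJ) _) => //=.
by rewrite /update /= range addnn -mul2n -expnS subnSK.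
Qed.

Lemma expect_random_flip (a : {set 'I_n} -> C) p (g : _ -> C) :
    (forall s v, \sum_T a T * output_weight v T <= g (Branch p s v)) ->
  forall s v,
  2^-1 ^+ J * \sum_(t < 2 ^ J) \sum_T a T * output_weight v (flip_nat t T)
    <= expect (10 * J).+4.+3 g [:: Branch (random_flip :: p) s v].
Proof.
move=> ag s v; do 5![rewrite expectationS /= big_seq1].
rewrite -[(10 * J).+2]addn1 expectationD.
pose h r (u : state C (n + w)) : C :=
  \sum_T a T * output_weight u (flip_nat r T).
have hcoin r c u : \sum_(b : bool)
    h r (collapse q c (hadamard q (collapse q b u))) = 2^-1 * h r u.
  rewrite exchange_big mulr_sumr; apply: eq_bigr => T _ /=.
  by rewrite -mulr_sumr output_weight_coin mulrCA.
have gh s1 u : h (s1 0 0)%N u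
    <= expect 1 g [:: Branch (Gate GateX index_cell :: p) s1 u].
  rewrite expectationS /= big_seq1 expectation0; apply: le_trans (ag _ _).
  by apply: ler_sum => T _; rewrite output_weight_pauliX.
apply: le_trans (expect_draw_index hcoin gh v (leqnn J) _); last first.
  by rewrite /update /= subnn.
by rewrite /update /= mul0n.
Qed.

(** In each round at least one of the [2 ^ J] equally likely indices brings [T] closer to [s0], so a
    round loses at most a factor [2 ^ J]. *)
Lemma expect_random_flips (a : C) (s0 : {set 'I_n}) p (g : _ -> C) :
    0 <= a ->
    (forall s v, a * output_weight v s0 <= g (Branch p s v)) ->
  forall M s v,
  a * 2^-1 ^+ (J * M) *
    \sum_(T | (#|symdiff T s0| <= M)%N) output_weight v T
  <= expect ((10 * J + 8) * M).+1 g [:: Branch (random_flips M :: p) s v].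
Proof.
move=> a0 ag; elim=> [|M IH] s v.
  rewrite !muln0 expr0 mulr1 expectationS /= big_seq1 expectation0.
  rewrite (big_pred1 s0) // => T; rewrite leqn0 cards_eq0; apply/eqP/eqP.
    move/setP=> sd0; apply/setP=> x; have := sd0 x.
    by rewrite !inE; do 2!case: (x \in _).
  by move=> ->; apply/setP=> x; rewrite !inE addbb.
have -> : ((10 * J + 8) * M.+1).+1
    = ((10 * J).+4.+3 + ((10 * J + 8) * M).+1).+1 by lia.
rewrite expectationS /= big_seq1 expectationD.
(* [b] is what the remaining [M] flips guarantee from the set [T]; it serves as the weight for the
   analysis of the first flip. *)
pose b T : C := if (#|symdiff T s0| <= M)%N then a * 2^-1 ^+ (J * M) else 0.
apply: le_trans (expect_random_flip (a := b) _ s v); last first.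
  move=> s1 u; apply: le_trans (IH s1 u).
  rewrite mulr_sumr [leRHS]big_mkcond /=; apply: ler_sum => T _.
  by rewrite /b; case: ifP => // _; rewrite mul0r.
rewrite mulnS exprD mulrCA -mulrA ler_wpM2l ?exprn_ge0 ?invr_ge0 ?ler0n //.
rewrite mulr_sumr.
have -> : \sum_(t < 2 ^ J) \sum_T b T * output_weight v (flip_nat t T)
    = \sum_T \sum_(t < 2 ^ J) b (flip_nat t T) * output_weight v T.
  rewrite [RHS]exchange_big; apply: eq_bigr => t _ /=.
  rewrite (reindex_inj (inv_inj (@flip_natK n t))).
  by apply: eq_bigr => T _; rewrite flip_natK.
have b0 T : 0 <= b T.
  by rewrite /b; case: ifP; rewrite ?mulr_ge0 ?exprn_ge0 ?invr_ge0 ?ler0n.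
rewrite big_mkcond; apply: ler_sum => T _; case: ifP => [TM|_]; last first.
  by apply: sumr_ge0 => t _; rewrite mulr_ge0 ?output_weight_ge0.
have [r rn rM] := flip_nat_closer TM.
rewrite (bigD1 (Ordinal (leq_ltn_trans rn (ltn_index_bits n)))) //=.
rewrite {1}/b rM lerDl; apply: sumr_ge0 => t _.
by rewrite mulr_ge0 ?output_weight_ge0.
Qed.

End RandomFlips.

(** * Running time and halting of the modified algorithm *)

Lemma poly_bound_gt0 d n : (0 < poly_bound d n)%N.
Proof. by rewrite /poly_bound; case: d => [|d]; rewrite ?expn0 // addnS. Qed.

(** The flips cost at most [(10 * n + 8) * M + 1] steps. For [n] at least 2 the larger exponent
    absorbs this; for [n] at most 1 powers do not grow, and the additive constant of [poly_bound]
    with [18 = 10 + 8] does. *)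
Lemma flips_time_bound d M n :
  ((poly_bound d n + ((10 * index_bits n + 8) * M).+1).+1
    <= poly_bound (d + 18 * M + 3) n)%N.
Proof.
have bits : (index_bits n <= n)%N by apply: up_log_min; rewrite // ltn_expl.
apply: (@leq_trans (poly_bound d n + ((10 * n + 8) * M).+1).+1).
  by rewrite ltnS leq_add2l ltnS leq_mul // leq_add2r leq_mul.
rewrite /poly_bound; case: n {bits} => [|[|n]].
- have -> : (0 ^ (d + 18 * M + 3) = 0)%N by rewrite exp0n // addnS.
  have : (0 ^ d <= 1)%N by case: d => // d; rewrite exp0n. 
  lia.
- rewrite !exp1n; lia.
- have : (18 * M + 1 <= n.+2 ^ (18 * M + 2))%N.
    rewrite addn1; apply: leq_trans (ltn_expl (18 * M) (isT : 1 < n.+2)%N) _.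
    by rewrite leq_exp2l // leq_addr.
  have d1 : (1 <= n.+2 ^ d)%N by rewrite expn_gt0.
  have -> : (d + 18 * M + 3 = (18 * M + 2) + 1 + d)%N by lia.
  rewrite !expnD expn1; move: (n.+2 ^ _)%N (n.+2 ^ d)%N d1 => X E E1 leX.
  have := leq_mul leX (leqnn (n.+2 * E)); have := leq_mul (leqnn (n.+2 * M)) E1.
  have := leq_mul (isT : 1 <= n.+2)%N (leqnn E); nia.
Qed.

Section Halting.
Variables (C : numClosedFieldType) (m n k : nat) (G : graph n).
Implicit Types (b : branch C m) (bs : seq (branch C m)).

Local Notation expect := (@expectation C m n k G).

Definition finished b : bool := (ket b == 0) || nilp (todo b).

(** All terms are nonpositive, so a nonnegative sum forces each to vanish. Lower bounds on
    expectations thereby yield statements about every branch. *)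
Lemma all_expectation t (P : pred (branch C m)) bs :
  0 <= expect t (fun b => - (~~ P b)%:R) bs ->
  all P (iter t (fun bs => flatten [seq step k G b | b <- bs]) bs).
Proof.
rewrite /expectation; elim: (iter _ _ _) => //= b bs' IH.
rewrite big_cons sumrN => ge0.
have Ple0 : 0 <= - (~~ P b)%:R :> C.
  by apply: le_trans ge0 _; rewrite gerDl oppr_le0 sumr_ge0.
have Pb : P b by move: Ple0; case: (P b); rewrite // oppr_ge0 lern0.
by rewrite Pb IH // sumrN; move: ge0; rewrite Pb oppr0 add0r.
Qed.

Lemma expectation_finished t u f bs : (forall b, ket b = 0 -> f b = 0) ->
    all finished (iter t (fun bs => flatten [seq step k G b | b <- bs]) bs) ->
  expect (t + u) f bs = expect t f bs.
Proof.
move=> f0; rewrite {1}/expectation addnC iterD -/(expect _ _ _) expectationE.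
rewrite /expectation; elim: (iter t _ _) => [|b bs' IH] /=; rewrite ?big_nil //.
move=> /andP[fin_b /IH IHbs]; rewrite !big_cons; congr (_ + _) => //.
case: b fin_b => p s v /orP[/eqP /= v0|/nilP /= ->]; last first.
  exact: expectation_idle.
by rewrite -/(expect _ _ _) expectation_ket0 // f0.
Qed.

End Halting.

Section RandomizedAlgorithm.
Variables (C : numClosedFieldType) (A : qpoly_algorithm C) (M : nat).

Local Notation A_time := (poly_bound (time_degree A)).
Local Notation work n := (poly_bound (work_degree A) n).
Local Notation flips_time n := ((10 * index_bits n + 8) * M).+1.
Local Notation start p :=
  (Branch [:: p] (fun _ _ => 0%N) (zero_ket C _)).
Local Notation flip_time_degree := (time_degree A + 18 * M + 3)%N.

(* Halting is read off the lower bounds on expectations, at weight 0 and for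
   minus the indicator of the unfinished branches. *)
Lemma random_flips_finish n k (G : graph n) s v :
  all (@finished C (n + work n))
    (iter (flips_time n) (fun bs => flatten [seq step k G b | b <- bs])
      [:: Branch [:: random_flips M] s v]).
Proof.
apply: all_expectation.
apply: le_trans (expect_random_flips k G (poly_bound_gt0 _ _) (lexx 0)
  (s0 := set0) _ M s v).
  by rewrite !mul0r.
by move=> s1 u; rewrite mul0r /finished orbT oppr0.
Qed.

Lemma entry_output_state n k (G : graph n) s :
  entry (output_state A k G) s s
  = expectation k G (A_time n)
      (fun b : branch C (n + work n) => output_weight (ket b) s)
      [:: start (program A)].
Proof.
rewrite /entry /output_state summxE; apply: eq_bigr => b _.
exact: entry_trace_out_work.
Qed.

Lemma tr_output_state n k (G : graph n) :
  \sum_s entry (output_state A k G) s s = 1.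
Proof.
under eq_bigr do rewrite entry_output_state.
rewrite /expectation exchange_big /=.
under eq_bigr do rewrite sum_output_weight.
by rewrite -/(expectation _ _ _ _ _) expectation_sqnorm sqnorm_zero_ket.
Qed.

Lemma entry_output_state_ge0 n k (G : graph n) s :
  0 <= entry (output_state A k G) s s.
Proof.
by rewrite entry_output_state sumr_ge0 // => b _; exact: output_weight_ge0.
Qed.

Lemma expectation_flips n k (G : graph n) (a : C) (s0 : {set 'I_n})
    (f : branch C (n + work n) -> C) :
    (k <= n)%N -> 0 <= a -> (forall b, ket b = 0 -> f b = 0) ->
    (forall s v, a * output_weight v s0 <= f (Branch [::] s v)) ->
  a * 2^-1 ^+ (index_bits n * M) *
    \sum_(T | (#|symdiff T s0| <= M)%N) entry (output_state A k G) T T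
  <= expectation k G (poly_bound flip_time_degree n) f
       [:: start (Seq (program A) (random_flips M))].
Proof.
move=> kn a0 f0 af.
have flipsE t s u : expectation k G (flips_time n + t) f
      [:: Branch [:: random_flips M] s u]
    = expectation k G (flips_time n) f [:: Branch [:: random_flips M] s u].
  by rewrite expectation_finished //; exact: random_flips_finish.
(* [t] is the slack in the time bound; the extra step unfolds the outer [Seq]. *)
have [t ->] : exists t,
    poly_bound flip_time_degree n = (A_time n + (flips_time n + t)).+1.
  have /subnKC <- := flips_time_bound (time_degree A) M n.
  by eexists; rewrite addSn -addnA.
rewrite expectationS /= big_seq1.
rewrite -[Branch _ _ _]/(with_suffix [:: random_flips M] (start (program A))).
rewrite expectation_suffix //; last first.
- exact: (halts_in_time A G kn).
- by move=> s v u; rewrite -addnA !flipsE.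
under eq_bigr do rewrite entry_output_state.
rewrite /expectation exchange_big mulr_sumr; apply: ler_sum => b _.
rewrite -/(expectation _ _ _ _ _) flipsE.
by apply: expect_random_flips => //; exact: poly_bound_gt0.
Qed.

Lemma flipped_halts n k (G : graph n) : (k <= n)%N ->
  halts C (n + poly_bound (work_degree A) n) k G
    (Seq (program A) (random_flips M)) (poly_bound flip_time_degree n).
Proof.
move=> kn; apply: (@all_expectation _ _ _ _ _ _ (@finished C _)).
apply: le_trans (@expectation_flips _ _ G 0 set0 _ kn (lexx 0) _ _).
- by rewrite !mul0r.
- by move=> b b0; rewrite /finished b0 eqxx oppr0.
- by move=> s v; rewrite mul0r /finished orbT oppr0.
Qed.

Definition flipped_algorithm : qpoly_algorithm C :=
  QPolyAlgorithm flipped_halts.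

Lemma output_flipped_algorithm n k (G : graph n) s0 : (k <= n)%N ->
  2^-1 ^+ (index_bits n * M) *
    \sum_(T | (#|symdiff T s0| <= M)%N) entry (output_state A k G) T T
  <= entry (output_state flipped_algorithm k G) s0 s0.
Proof.
move=> kn; rewrite /entry [output_state flipped_algorithm k G]/output_state.
rewrite summxE -[2^-1 ^+ _]mul1r.
rewrite (eq_bigr (fun b => output_weight (ket b) s0)); last first.
  by move=> b _; exact: entry_trace_out_work.
rewrite -/(expectation _ _ _ (fun b => output_weight (ket b) s0) _).
apply: expectation_flips => // [b ->|s v]; first exact: output_weight0.
by rewrite mul1r.
Qed.

End RandomizedAlgorithm.

(** * Cliques of the planted graph *)

(** All graphs have equal weight, and complementation turns the supergraphs of [E] into the subsets
    of [~: E]. *)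
Lemma ER_weight_superset (F : numFieldType) n (E : {set edge n}) :
  \sum_(G : graph n | E \subset G) ER_weight 2^-1 G = 2^-1 ^+ #|E| :> F.
Proof.
have half : 1 - 2^-1 = 2^-1 :> F by rewrite {1}[1](splitr 1) mul1r addrK.
rewrite (eq_bigr (fun=> 2^-1 ^+ #|{: edge n}|)); last first.
  move=> G _; rewrite /ER_weight half -prodr_const.
  by apply: eq_bigr => e _; rewrite if_same.
rewrite big_const iter_addr_0 -[X in _ *+ X](card_imset _ (inv_inj (@setCK _))).
rewrite (_ : _ @: _ = powerset (~: E)); last first.
  apply/setP=> G; rewrite inE -[G in RHS]setCK setCS.
  by rewrite -[G in LHS]setCK mem_imset //; exact: (inv_inj (@setCK _)).
rewrite card_powerset -(cardsC E) exprD -mulrnAr -[X in _ * X]mulr_natr natrX.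
by rewrite -exprMn mulVf ?expr1n ?mulr1 // pnatr_eq0.
Qed.

Lemma ER_weight_ge0 (F : numFieldType) n (G : graph n) :
  0 <= ER_weight 2^-1 G :> F.
Proof.
apply: prodr_ge0 => e _; case: ifP => _; first by rewrite invr_ge0 ler0n.
by rewrite subr_ge0 invf_le1 ?ltr0n // ler1n.
Qed.

(** The pairs inside [T] that planting does not supply: if [T] is a clique, they must all come from
    the random graph. *)
Definition outer_edges n (S T : {set 'I_n}) : {set edge n} :=
  [set e : edge n | (val e \subset T) && ~~ (val e \subset S)].

Lemma outer_edges_plant n (G0 : graph n) (S T : {set 'I_n}) :
  is_clique (plant G0 S) T -> outer_edges S T \subset G0.
Proof.
move=> /forall_inP cliqueT; apply/subsetP => e; rewrite inE => /andP[eT eS].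
have /cards2P[i [j [ij eE]]] := valP e.
have [iT jT] : i \in T /\ j \in T.
  by split; apply: (subsetP eT); rewrite eE !inE eqxx ?orbT.
have /forall_inP/(_ j jT)/implyP/(_ ij) := cliqueT i iT.
case/exists_inP => e' e'G /eqP e'E.
have ee' : e' = e by apply: val_inj; rewrite e'E eE.
by move: e'G; rewrite ee' !inE (negPf eS) orbF.
Qed.

Lemma card_outer_edges n (S T : {set 'I_n}) :
  #|outer_edges S T| = ('C(#|T|, 2) - 'C(#|T :&: S|, 2))%N.
Proof.
rewrite -!cards_draws -cardsDS; last first.
  by apply/subsetP => e; rewrite !inE subsetI => /andP[/andP[-> _] ->].
rewrite -(card_imset _ val_inj); congr #|pred_of_set _|; apply/setP => e.
apply/imsetP/idP => [[f + ->]|].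
  by rewrite !inE subsetI (valP f) !andbT => /andP[-> ->].
rewrite !inE subsetI => /andP[eS /andP[eT e2]].
exists (exist _ e e2) => //; rewrite inE eT /=.
by move: eS; rewrite eT e2 andbT.
Qed.

(** Each of the [m] new points lies in [a + m - 1] pairs, and a pair is counted at most twice this
    way. *)
Lemma bin2_diff a m : (m * (a + m).-1 + 'C(a, 2).*2 <= 'C(a + m, 2).*2)%N.
Proof.
elim: m => [|m IH]; first by rewrite addn0.
rewrite addnS binS bin1 /=; case: (a + m)%N (leq_addl a m) IH => [|s] /= ms IH.
  by lia.
by nia.
Qed.

Lemma card_outer_edges_ge n k (S T : {set 'I_n}) : #|T| = k.-1 ->
  (#|T :\: S| * (k - 2)./2 <= #|outer_edges S T|)%N.
Proof.
move=> Tk; rewrite card_outer_edges -(cardsID S T).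
have := bin2_diff #|T :&: S| #|T :\: S|; rewrite cardsID Tk.
have := odd_double_half (k - 2); have : k.-1.-1 = (k - 2)%N by lia.
move=> -> ; nia.
Qed.

Lemma bin_leq_exp n m : ('C(n, m) <= n ^ m)%N.
Proof.
apply: (@leq_trans (n ^_ m)).
  by rewrite -bin_ffact leq_pmulr // fact_gt0.
elim: m n => [|m IH] n; first by [].
rewrite ffactnS expnS leq_mul2l (leq_trans (IH _)) ?orbT //.
case: m {IH} => // m; rewrite leq_exp2r ?leq_pred //.
Qed.

(** [T] is determined by [T :\: S] and [S :\: T], and the sizes of [S] and [T] force the latter to
    have [m.+1] elements. *)
Lemma card_overlap n (k m : nat) (S : {set 'I_n}) : #|S| = k -> (0 < k)%N ->
  (#|[set T : {set 'I_n} | (#|T| == k.-1) && (#|T :\: S| == m)]|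
    <= n ^ m * k ^ m.+1)%N.
Proof.
move=> Sk k0; set X := [set _ | _].
pose Y := setX [set A : {set 'I_n} | A \subset [set: 'I_n] & #|A| == m]
               [set B : {set 'I_n} | B \subset S & #|B| == m.+1].
apply: (@leq_trans #|Y|); last first.
  by rewrite cardsX !cards_draws cardsT card_ord Sk leq_mul ?bin_leq_exp.
pose f (T : {set 'I_n}) := (T :\: S, S :\: T).
have f_inj : injective f.
  move=> T1 T2 [e1 e2]; apply/setP => x.
  move/setP/(_ x): e1; move/setP/(_ x): e2; rewrite !inE.
  by case: (x \in S); case: (x \in T1); case: (x \in T2).
rewrite -(card_imset _ f_inj); apply: subset_leq_card.
apply/subsetP => _ /imsetP[T + ->]; rewrite !inE subsetT subsetDl /=.
move=> /andP[/eqP Tk /eqP Tm]; rewrite Tm eqxx /=; apply/eqP.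
have := cardsID T S; rewrite setIC Sk => ST.
by apply/(@addnI #|T :&: S|); rewrite ST addnS -Tm cardsID Tk prednK.
Qed.

Definition far_clique n (G : graph n) (S : {set 'I_n}) (L : nat) : bool :=
  [exists T : {set 'I_n},
    [&& #|T| == #|S|.-1, is_clique G T & (L < #|T :\: S|)%N]].

(** Union bound over [T], grouped by the number [m] of vertices outside [S]. By the counts of sets
    and of outer edges a group contributes at most [k * x ^ m]; only [m > L] occurs, there are at
    most [k] groups, and [x <= 1]. *)
Lemma far_clique_le (F : realFieldType) n k L (S : {set 'I_n}) :
    #|S| = k -> (0 < k)%N ->
    (n * k)%:R * 2^-1 ^+ (k - 2)./2 <= 1 :> F ->
  \sum_(G0 : graph n) ER_weight 2^-1 G0 * (far_clique (plant G0 S) S L)%:R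
    <= k%:R ^+ 2 * ((n * k)%:R * 2^-1 ^+ (k - 2)./2) ^+ L.+1 :> F.
Proof.
move=> Sk k0; set y : F := 2^-1 ^+ _; set x : F := _ * y => x1.
have x0 : 0 <= x by rewrite mulr_ge0 ?ler0n ?exprn_ge0 ?invr_ge0.
have half01 : (0 <= 2^-1 :> F) && (2^-1 <= 1 :> F).
  by rewrite invr_ge0 ler0n invf_le1 ?ltr0n // ler1n.
pose far (T : {set 'I_n}) := (#|T| == k.-1) && (L < #|T :\: S|)%N.
have union (G0 : graph n) : (far_clique (plant G0 S) S L)%:R
    <= \sum_(T | far T) (outer_edges S T \subset G0)%:R :> F.
  case: (boolP (far_clique _ _ _)) => [/existsP[T /and3P[Tk Tc TL]]|_];
    last by apply: sumr_ge0.
  rewrite (bigD1 T) /=; last by rewrite /far -Sk Tk TL.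
  by rewrite (outer_edges_plant Tc) lerDl sumr_ge0.
apply: (@le_trans _ _ (\sum_(T | far T) 2^-1 ^+ #|outer_edges S T|)).
  under [leRHS]eq_bigr do rewrite -ER_weight_superset big_mkcond.
  rewrite exchange_big; apply: ler_sum => G0 _ /=.
  apply: le_trans (ler_wpM2l (ER_weight_ge0 _ _) (union G0)) _.
  rewrite mulr_sumr; apply: ler_sum => T _.
  by case: ifP => _; rewrite ?mulr1 ?mulr0.
have inner m :
    \sum_(T : {set 'I_n} | (#|T| == k.-1) && (#|T :\: S| == m)) y ^+ m
    <= k%:R * x ^+ m.
  rewrite sumr_const -[leLHS]mulr_natl /x exprMn mulrA ler_wpM2r ?exprn_ge0 //.
    by case/andP: half01.
  rewrite -natrX -natrM ler_nat -cardsE.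
  by apply: leq_trans (card_overlap _ Sk k0) _; rewrite expnMn expnS mulnCA.
have far_lt T : far T -> (#|T :\: S| < k)%N.
  move=> /andP[/eqP Tk _]; rewrite -(prednK k0) ltnS -Tk.
  exact/subset_leq_card/subsetDl.
pose idx (T : {set 'I_n}) : 'I_k.-1.+1 := inord #|T :\: S|.
have idxE T : far T -> idx T = #|T :\: S| :> nat.
  by move=> farT; rewrite inordK // prednK // far_lt.
rewrite (partition_big idx predT) //=.
apply: (@le_trans _ _ (\sum_(m < k.-1.+1) k%:R * x ^+ L.+1)); last first.
  by rewrite sumr_const card_ord prednK // -[leLHS]mulr_natl mulrA expr2.
apply: ler_sum => m _; have [mL|Lm] := leqP m L.
  rewrite big1 ?mulr_ge0 ?exprn_ge0 ?ler0n // => T /andP[farT /eqP Tm].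
  by case/andP: (farT) => _; rewrite -(idxE T farT) Tm ltnNge mL.
apply: (@le_trans _ _ (k%:R * x ^+ m)); last first.
  by rewrite ler_wpM2l ?ler0n // ler_wiXn2l.
apply: le_trans (inner m); rewrite [leRHS]big_mkcond [leLHS]big_mkcond /=.
apply: ler_sum => T _; case: ifP => [/andP[farT /eqP Tm]|_]; last first.
  by case: ifP; rewrite ?exprn_ge0 //; case/andP: half01.
have TmE : #|T :\: S| = m by rewrite -(idxE T farT) Tm.
have /andP[Tk _] := farT; rewrite Tk TmE eqxx /=.
rewrite /y -exprM ler_wiXn2l //; [by case/andP: half01..|].
by rewrite mulnC -TmE card_outer_edges_ge //; exact/eqP.
Qed.

(** * Success probability of the modified algorithm *)

Lemma entry_simplex_state (C : numClosedFieldType) n (G : graph n) d s :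
  entry (projector (simplex_state C G d)) s s
  = if s \in simplices G d then #|simplices G d|%:R^-1 else 0.
Proof.
rewrite entry_operator_of -normCK ffunE; case: ifP => _; last first.
  by rewrite normr0 expr0n.
by rewrite normfV ger0_norm ?sqrtC_ge0 ?ler0n // exprVn sqrtCK.
Qed.

Lemma simplices_weight (C : numClosedFieldType) (A : qpoly_algorithm C)
    n k (G : graph n) d (tau : C) :
    simplices G d != set0 ->
    trace_distance (output_state A k G) (projector (simplex_state C G d))
      <= tau ->
  1 - tau <= \sum_(T in simplices G d) entry (output_state A k G) T T.
Proof.
move=> G0; apply: measure_trace_distance.
- exact: tr_output_state.
- by apply/ger0_real/sumr_ge0 => T _; exact: entry_output_state_ge0.
- rewrite (eq_bigr (fun=> #|simplices G d|%:R^-1)); last first.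
    by move=> T Td; rewrite entry_simplex_state Td.
  rewrite sumr_const -[LHS]mulr_natr mulVf // pnatr_eq0 cards_eq0 //.
- by move=> T /negPf Td; rewrite entry_simplex_state Td.
Qed.

Lemma is_clique_plant n (G0 : graph n) (S : {set 'I_n}) :
  is_clique (plant G0 S) S.
Proof.
apply/forall_inP => i iS; apply/forall_inP => j jS; apply/implyP => ij.
have e2 : #|[set i; j]| == 2%N by rewrite cards2 ij.
apply/exists_inP; exists (exist _ [set i; j] e2); last by [].
by rewrite !inE /= subUset !sub1set iS jS orbT.
Qed.

Lemma is_clique_sub n (G : graph n) (S T : {set 'I_n}) :
  T \subset S -> is_clique G S -> is_clique G T.
Proof.
move=> /subsetP TS /forall_inP cS; apply/forall_inP => i iT.
apply/forall_inP => j jT.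
by have /forall_inP := cS i (TS i iT); apply; exact: TS.
Qed.

Lemma card_symdiff (T : finType) (s t : {set T}) :
  #|symdiff s t| = (#|s :\: t| + #|t :\: s|)%N.
Proof.
rewrite -cardsUI (_ : _ :&: _ = set0) ?cards0 ?addn0; last first.
  by apply/setP=> x; rewrite !inE; case: (x \in s); case: (x \in t).
congr #|pred_of_set _|; apply/setP=> x; rewrite !inE.
by case: (x \in s); case: (x \in t).
Qed.

Section Success.
Variables (R : realType) (A : qpoly_algorithm R[i]) (L : nat).

Local Notation B := (flipped_algorithm A (2 * L + 1)).

Lemma planted_entry_ge n k (G0 : graph n) (S : {set 'I_n}) (tau : R) :
    #|S| = k -> (1 < k <= n)%N -> ~~ far_clique (plant G0 S) S L ->
    trace_distance (output_state A k (plant G0 S))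
      (projector (simplex_state R[i] (plant G0 S) (k - 2))) <= tau%:C%C ->
  2^-1 ^+ (index_bits n * (2 * L + 1)) * (1 - tau)
    <= complex.Re (entry (output_state B k (plant G0 S)) S S).
Proof.
move=> Sk /andP[k1 kn] near dist; set G := plant G0 S in near dist *.
have k2 : (k - 2).+1 = k.-1 by lia.
(* Removing one vertex from the planted clique leaves a simplex, nonempty because [1 < k]. *)
have simplex0 : simplices G (k - 2) != set0.
  have /card_gt0P[i iS] : (0 < #|S|)%N by lia.
  apply/set0Pn; exists (S :\ i).
  rewrite !inE k2 -Sk (cardsD1 i S) iS eqxx andbT.
  rewrite (is_clique_sub (subD1set S i) (is_clique_plant _ _)) andbT.
  by rewrite -card_gt0; have := cardsD1 i S; rewrite iS; lia.
(* [T] has one vertex fewer than [S], so [S :\: T] has one more element than [T :\: S]; this gives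
   [L + (L + 1)]. *)
have close T : T \in simplices G (k - 2) -> (#|symdiff T S| <= 2 * L + 1)%N.
  rewrite !inE k2 => /andP[/andP[_ cT] /eqP Tk].
  have TL : (#|T :\: S| <= L)%N.
    rewrite leqNgt; apply: contra near => LT; apply/existsP; exists T.
    by rewrite Sk Tk eqxx cT.
  rewrite card_symdiff; have := cardsID S T; have := cardsID T S.
  by rewrite setIC Sk Tk; lia.
suff : (2^-1 ^+ (index_bits n * (2 * L + 1)) * (1 - tau))%:C%C
    <= entry (output_state B k G) S S by rewrite lecE /= => /andP[].
apply: le_trans (output_flipped_algorithm A _ G S kn).
rewrite rmorphM rmorphXn fmorphV rmorphB rmorph1 rmorph_nat.
rewrite ler_wpM2l ?exprn_ge0 ?invr_ge0 ?ler0n //.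
apply: le_trans (simplices_weight simplex0 dist) _.
rewrite big_mkcond [leRHS]big_mkcond; apply: ler_sum => T _.
case: ifP => [/close ->|_] //.
by case: ifP => // _; exact: entry_output_state_ge0.
Qed.

Lemma search_success_ge n k (tau : R) : (1 < k <= n)%N -> tau <= 1 ->
    (n * k)%:R * 2^-1 ^+ (k - 2)./2 <= 1 :> R ->
  2^-1 ^+ (index_bits n * (2 * L + 1)) * (1 - tau) *
    (planted_probability R k (fun G : graph n =>
       trace_distance (output_state A k G)
         (projector (simplex_state R[i] G (k - 2))) <= tau%:C%C)
     - k%:R ^+ 2 * ((n * k)%:R * 2^-1 ^+ (k - 2)./2) ^+ L.+1)
  <= search_success B n k.
Proof.
move=> k1n tau1 x1; have /andP[k1 kn] := k1n; set P := fun G => _.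
have k0 : (0 < k)%N by exact: ltnW.
set a := _ * (1 - tau).
have a0 : 0 <= a by rewrite mulr_ge0 ?exprn_ge0 ?invr_ge0 ?ler0n ?subr_ge0.
have Re_ge0 (G : graph n) s : 0 <= complex.Re (entry (output_state B k G) s s).
  by have := entry_output_state_ge0 B k G s; rewrite lecE /= => /andP[].
(* Only the answer [S] itself is counted. If the preparation fails or a far clique exists, the left
   side is at most 0. *)
have pointwise (G0 : graph n) (S : {set 'I_n}) : #|S| == k ->
    a * ((P (plant G0 S))%:R - (far_clique (plant G0 S) S L)%:R)
    <= \sum_(s | is_clique (plant G0 S) s && (#|s| == k))
         complex.Re (entry (output_state B k (plant G0 S)) s s).
  move=> /eqP Sk; rewrite (bigD1 S) /=; last by rewrite is_clique_plant Sk eqxx.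
  rewrite -[leLHS]addr0; apply: lerD; last exact: sumr_ge0.
  case: (boolP (P _)) => [dist|_]; last first.
    apply: le_trans (Re_ge0 _ _).
    by rewrite mulr_ge0_le0 // sub0r oppr_le0 ler0n.
  case: (boolP (far_clique _ _ _)) => [_|near]; first by rewrite subrr mulr0.
  by rewrite subr0 mulr1 planted_entry_ge.
have binV : 'C(n, k)%:R * 'C(n, k)%:R^-1 = 1 :> R.
  by rewrite mulfV // pnatr_eq0 -lt0n bin_gt0.
have farE : \sum_(G0 : graph n) ER_weight 2^-1 G0 *
    \sum_(S : {set 'I_n} | #|S| == k)
      'C(n, k)%:R^-1 * (far_clique (plant G0 S) S L)%:R
    <= k%:R ^+ 2 * ((n * k)%:R * 2^-1 ^+ (k - 2)./2) ^+ L.+1 :> R.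
  under eq_bigr do rewrite mulr_sumr; rewrite exchange_big /=.
  apply: (@le_trans _ _ (\sum_(S : {set 'I_n} | #|S| == k) 'C(n, k)%:R^-1 *
    (k%:R ^+ 2 * ((n * k)%:R * 2^-1 ^+ (k - 2)./2) ^+ L.+1))).
    apply: ler_sum => S /eqP Sk; under eq_bigr do rewrite mulrCA.
    rewrite -mulr_sumr ler_wpM2l ?invr_ge0 ?ler0n //.
    exact: far_clique_le.
  rewrite sumr_const -cardsE card_draws card_ord -[leLHS]mulr_natl mulrA binV.
  by rewrite mul1r.
apply: le_trans (ler_wpM2l a0 (lerB (lexx _) farE)) _.
rewrite /planted_probability /search_success /planted_expectation.
rewrite -sumrB mulr_sumr.
apply: ler_sum => G0 _; rewrite -mulrBr -sumrB mulrCA.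
rewrite ler_wpM2l ?ER_weight_ge0 // mulr_sumr; apply: ler_sum => S Sk.
by rewrite -mulrBr mulrCA ler_wpM2l ?invr_ge0 ?ler0n // pointwise.
Qed.

End Success.

(** * Asymptotics *)

Section Asymptotics.
Variable R : realType.
Implicit Types (eps c B l : R) (n k : nat).

Lemma near_ln_ge B : \forall n \near \oo%classic, B <= ln (n%:R : R).
Proof.
apply: filterS (nbhs_infty_ger (expR B)) => n Bn.
rewrite -[leLHS]expRK ler_ln ?posrE ?expR_gt0 //.
exact: lt_le_trans (expR_gt0 B) Bn.
Qed.

Lemma ln_gt0_inv n : 0 < ln (n%:R : R) -> (1 < n)%N.
Proof.
case: n => [|[|n]] //; first by rewrite ln0 ?ltxx.
by rewrite ln1 ltxx.
Qed.

Lemma powR_ln n (a : R) : (0 < n)%N -> n%:R `^ a = expR (a * ln n%:R).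
Proof. by case: n => // n _; rewrite /powR pnatr_eq0. Qed.

(* Writing [k ln 2 = (1 - eta) k ln 2 + eta k ln 2] with
   [(1 - eta) (2 + eps) = 2 + eps / 2], the first part absorbs [n ^ 2] and the
   second the polynomial factor in [k]. *)
Lemma overlap_ratio_le eps : 0 < eps -> exists B, forall n k,
    B <= ln (n%:R : R) -> (2 + eps) * ln n%:R <= k%:R * ln 2 ->
  (n * k)%:R * 2^-1 ^+ (k - 2)./2 <= expR (- (eps / 8 * ln (n%:R : R))).
Proof.
move=> eps0; have ln2 : 0 < ln 2 :> R by rewrite ln_gt0 // ltr1n.
(* [theta] makes [eta * (k%:R * ln 2)] twice [k%:R * theta], so that [y <= expR y] at
   [y = k%:R * theta] absorbs the factor [k ^ 2]. *)
pose eta := eps / 2 / (2 + eps); pose theta := eta * ln 2 / 2.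
have eps2 : 0 < 2 + eps by rewrite addr_gt0.
have eta0 : 0 < eta by rewrite !divr_gt0.
have theta0 : 0 < theta by rewrite divr_gt0 // mulr_gt0.
(* Past this threshold [8 / theta ^+ 2] is at most [n ^ (eps / 4)], half of the gain [n ^ (eps / 2)]
   available for the squared ratio. *)
exists (Num.max 1 (4 / eps * ln (8 / theta ^+ 2))) => n k.
set l := ln n%:R; rewrite ge_max => /andP[l1 lB] kl.
have n1 : (1 < n)%N by apply: ln_gt0_inv; exact: lt_le_trans l1.
have nE : n%:R = expR l by rewrite lnK // posrE ltr0n ltnW.
rewrite -(@ler_pXn2r _ 2) ?nnegrE ?expR_ge0 //; last first.
  by rewrite mulr_ge0 ?ler0n ?exprn_ge0 ?invr_ge0 ?ler0n.
(* Truncated subtraction and halving lose at most 3 in the doubled exponent, hence the factor 8. *)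
have half_le : (2^-1 ^+ (k - 2)./2) ^+ 2 <= 8 * expR (- (k%:R * ln 2)) :> R.
  rewrite -exprM muln2 mulrC -ler_pdivrMr // expRN mulrC expRM_natl.
  rewrite lnK ?posrE // -exprVn -(_ : 2^-1 ^+ 3 = 8^-1); last first.
    by rewrite exprVn -natrX.
  rewrite -exprD ler_wiXn2l ?invr_ge0 ?invf_le1 ?ler1n //.
  by have := odd_double_half (k - 2); case: (odd _) => /=; lia.
have k_le : k%:R ^+ 2 * expR (- (eta * (k%:R * ln 2))) <= theta ^- 2.
  have kt : k%:R * theta <= expR (k%:R * theta).
    by apply: le_trans (expR_ge1Dx _); rewrite lerDr.
  rewrite expRN ler_pdivrMr ?expR_gt0 // mulrC ler_pdivlMr ?exprn_gt0 //.
  rewrite -exprMn (_ : eta * _ = 2%:R * (k%:R * theta)); last first.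
    by rewrite /theta; field.
  by rewrite expRM_natl ler_pXn2r ?nnegrE ?expR_ge0 // mulr_ge0 // ltW.
have etaE : eta * (2 + eps) = eps / 2 by rewrite /eta divfK // gt_eqF.
have eta1 : 0 <= 1 - eta.
  by rewrite subr_ge0 /eta ler_pdivrMr // mul1r; lra.
have exponent : 2 * l - k%:R * ln 2 <= - (eps / 2 * l) - eta * (k%:R * ln 2).
  have : 0 <= (1 - eta) * (k%:R * ln 2 - (2 + eps) * l).
    by rewrite mulr_ge0 // subr_ge0.
  have -> : (1 - eta) * (k%:R * ln 2 - (2 + eps) * l)
    = k%:R * ln 2 - eta * (k%:R * ln 2) - (2 + eps) * l + eta * (2 + eps) * l.
    by ring.
  by rewrite etaE; lra.
have bound : 8 / theta ^+ 2 <= expR (eps / 4 * l).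
  rewrite -[leLHS]lnK ?posrE ?divr_gt0 ?exprn_gt0 // ler_expR.
  rewrite -(@ler_pM2l _ (4 / eps)) ?divr_gt0 //.
  apply: le_trans lB _; rewrite -[leLHS]mul1r.
  by rewrite (_ : 4 / eps * (eps / 4 * l) = 1 * l) //; field; rewrite gt_eqF.
have -> : expR (- (eps / 8 * l)) ^+ 2
    = expR (eps / 4 * l) * expR (- (eps / 2 * l)).
  by rewrite -expRM_natl -expRD; congr expR; field.
rewrite exprMn natrM exprMn nE -expRM_natl.
apply: (@le_trans _ _ (8 * k%:R ^+ 2 * expR (2 * l - k%:R * ln 2))).
  apply: le_trans (ler_wpM2l _ half_le) _.
    by rewrite mulr_ge0 ?expR_ge0 ?exprn_ge0.
  rewrite expRD [leLHS](_ : _ =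
    8 * k%:R ^+ 2 * (expR (2 * l) * expR (- (k%:R * ln 2)))) //.
  by ring.
apply: (@le_trans _ _ (8 / theta ^+ 2 * expR (- (eps / 2 * l)))); last first.
  by rewrite ler_wpM2r ?expR_ge0.
rewrite -[leLHS]mulrA -[leRHS]mulrA ler_wpM2l ?ler0n //.
apply: (@le_trans _ _ (k%:R ^+ 2 * expR (- (eta * (k%:R * ln 2))) *
    expR (- (eps / 2 * l)))); last by rewrite ler_wpM2r ?expR_ge0.
by rewrite -mulrA -expRD ler_wpM2l ?exprn_ge0 ?ler0n // ler_expR [leRHS]addrC.
Qed.

(** As [x] is at most [n ^ (- eps / 8)], taking [L] with [(L + 1) * eps / 8 >= c + 2] gives
    [x ^ (L + 1) <= n ^ (- c - 2)]. The upper bound on [k] gives [k ^ 2 <= n], and the spare factor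
    [1 / n] is at most 1/2. *)
Lemma far_clique_bound eps c : 0 < eps -> 0 < c -> exists L B, forall n k,
    B <= ln (n%:R : R) ->
    (2 + eps) * log2 n%:R <= k%:R <= (n%:R : R) `^ (2^-1 - eps) ->
  let x := (n * k)%:R * 2^-1 ^+ (k - 2)./2 in
  [/\ (1 < k <= n)%N, x <= 1 :> R & k%:R ^+ 2 * x ^+ L.+1 <= n%:R `^ (- c) / 2].
Proof.
move=> eps0 c0; have [B ratio] := overlap_ratio_le eps0.
have ln2 : 0 < ln 2 :> R by rewrite ln_gt0 // ltr1n.
have [L cL] : exists L : nat, c + 2 <= eps / 8 * L.+1%:R.
  have q0 : 0 <= (c + 2) / (eps / 8).
    by rewrite divr_ge0 // ltW // ?divr_gt0 // addr_gt0.
  exists (Num.trunc ((c + 2) / (eps / 8))).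
  rewrite mulrC -ler_pdivrMr ?divr_gt0 //.
  by have /andP[_ /ltW] := truncn_itv q0.
exists L, (Num.max 1 B) => n k; rewrite ge_max => /andP[l1 lB] /andP[lo hi] x.
have n1 : (1 < n)%N by apply: ln_gt0_inv; exact: lt_le_trans l1.
have n0 : (0 < n)%N by exact: ltnW.
have kl : (2 + eps) * ln n%:R <= k%:R * ln 2.
  by rewrite -ler_pdivrMr // -mulrA.
have nE : n%:R = expR (ln n%:R) :> R by rewrite lnK // posrE ltr0n.
rewrite !powR_ln // in hi *; have {ratio} := ratio n k lB kl.
rewrite -/x; set l := ln n%:R in l1 lB kl nE hi * => x_le.
have k1 : (1 < k)%N.
  rewrite ltnNge; apply/negP => k1.
  have : k%:R * ln 2 <= 2 :> R.
    apply: (@le_trans _ _ (1 * ln 2)); first by rewrite ler_wpM2r ?lern1 // ltW.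
    by rewrite mul1r ltW // ln_sublinear.
  apply/negP; rewrite -ltNge; apply: lt_le_trans kl; nra.
have k2 : k%:R ^+ 2 <= expR l.
  apply: (@le_trans _ _ (expR ((2^-1 - eps) * l) ^+ 2)).
    by rewrite ler_pXn2r ?nnegrE ?expR_ge0.
  rewrite -expRM_natl ler_expR; nra.
have x0 : 0 <= x by rewrite mulr_ge0 ?exprn_ge0 ?invr_ge0.
split.
- rewrite k1 /= -(ler_nat R) nE; apply: le_trans k2.
  by rewrite expr2 ler_peMl // ler1n ltnW.
- apply: le_trans x_le _; rewrite -[leRHS]expR0 ler_expR oppr_le0.
  by rewrite mulr_ge0 ?divr_ge0 ?ltW //; lra.
- apply: (@le_trans _ _ (expR l * expR (- (c + 2) * l))).
    apply: ler_pM => //; [exact: exprn_ge0 | exact: exprn_ge0 |].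
    apply: (@le_trans _ _ (expR (- (eps / 8 * l)) ^+ L.+1)).
      by rewrite ler_pXn2r ?nnegrE ?expR_ge0.
    rewrite -expRM_natl ler_expR.
    have : (c + 2) * l <= eps / 8 * L.+1%:R * l by rewrite ler_wpM2r //; lra.
    have -> : L.+1%:R * - (eps / 8 * l) = - (eps / 8 * L.+1%:R * l) by ring.
    by lra.
  have -> : expR l * expR (- (c + 2) * l) = expR (- c * l) * (expR l)^-1.
    by rewrite -expRN -!expRD; congr expR; ring.
  rewrite ler_wpM2l ?expR_ge0 // lef_pV2 ?posrE ?expR_gt0 // -nE.
  by rewrite ler_nat.
Qed.
End Asymptotics.

Lemma expn_index_bits_le n : (0 < n)%N -> (2 ^ index_bits n <= 2 * n)%N.
Proof.
move=> n0; have := ltn_index_bits n; have := @expn_index_bits n.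
case: (index_bits n) => [_|J expJ _]; first by case: n n0.
by rewrite expnS leq_mul2l expJ.
Qed.

Theorem corollary2 (R : realType) (eps : R) (k : nat -> nat) :
  0 < eps < 2^-1 ->
  (\forall n \near \oo%classic,
     (2 + eps) * log2 n%:R <= (k n)%:R <= n%:R `^ (2^-1 - eps)) ->
  quantum_strong_search_conjecture R ->
  forall c tau : R, 0 < c -> 0 < tau < 1 ->
  ~ exists A : qpoly_algorithm R[i],
      \forall n \near \oo%classic,
        n%:R `^ (- c) <=
        planted_probability R (k n) (fun G : graph n =>
          trace_distance (output_state A (k n) G)
            (projector (simplex_state R[i] G (k n - 2))) <= tau%:C%C).
Proof.
move=> /andP[eps0 eps_half] krange conj c tau c0 /andP[tau0 tau1] [A succ].
have [L [B bound]] := far_clique_bound eps0 c0.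
(* In [c'], [c] pays for the success rate of the preparation, [2 * M] for the flips, and 1 for the
   constant [(1 - tau) / 2]. *)
pose M := (2 * L + 1)%N; pose c' := c + 2 * M%:R + 1.
have M0 : (0 < M)%N by rewrite /M addn1.
have c'0 : 0 < c' by rewrite /c' !addr_gt0 // mulr_gt0 // ltr0n.
have eps_range : 0 < eps < 2^-1 by rewrite eps0.
have fails := conj eps eps c' eps0 eps_range c'0 (flipped_algorithm A M).
(* The last bound makes [1 / n] strictly smaller than [(1 - tau) / 2]. *)
have large := near_ln_ge (Num.max (Num.max 1 B) (ln (2 / (1 - tau)) + 1)).
have [n [[[kn succn] failn] largen]] :=
  filter_ex (filterI (filterI (filterI krange succ) fails) large).
move: largen; rewrite !ge_max => /andP[/andP[l1 lB] ltau].
have n1 : (1 < n)%N by apply: ln_gt0_inv; exact: lt_le_trans l1.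
have n0 : (0 < n)%N by exact: ltnW.
have [k1n x1 far] := bound n (k n) lB kn.
have := le_trans (search_success_ge A L k1n (ltW tau1) x1) (failn (k n) kn).
rewrite leNgt => /negP; apply; rewrite -/M.
set P := planted_probability _ _ _ in succn *.
set x := _ ^+ L.+1 in far *.
have nE : n%:R = expR (ln n%:R) :> R by rewrite lnK // posrE ltr0n.
have gap : n%:R `^ (- c) / 2 <= P - (k n)%:R ^+ 2 * x.
  have -> : n%:R `^ (- c) / 2 = n%:R `^ (- c) - n%:R `^ (- c) / 2 by field.
  exact: lerB.
(* Each flip has at most [2 * n <= n ^ 2] equally likely indices. *)
have flip_prob :
    expR (- (2 * M%:R * ln n%:R)) <= 2^-1 ^+ (index_bits n * M) :> R.
  rewrite exprM (_ : - _ = M%:R * - (2 * ln n%:R)); last by ring.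
  rewrite expRM_natl ler_pXn2r ?nnegrE ?expR_ge0 ?exprn_ge0 ?invr_ge0 //.
  rewrite expRN exprVn lef_pV2 ?posrE ?expR_gt0 ?exprn_gt0 // expRM_natl -nE.
  rewrite -!natrX ler_nat; apply: leq_trans (expn_index_bits_le n0) _.
  by rewrite expnS expn1 leq_mul2r n1 orbT.
have tau1' : 0 < 1 - tau by rewrite subr_gt0.
apply: (@lt_le_trans _ _ (expR (- (2 * M%:R * ln n%:R)) * (1 - tau) *
    (n%:R `^ (- c) / 2))); last first.
  apply: ler_pM => //; last by rewrite ler_wpM2r // ltW.
    by rewrite mulr_ge0 ?expR_ge0 // ltW.
  by rewrite divr_ge0 ?powR_ge0.
rewrite !powR_ln //; move: (ln n%:R) ltau => l ltau.
have -> : expR (- c' * l)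
    = expR (- (2 * M%:R * l)) * expR (- c * l) * expR (- l).
  by rewrite -!expRD; congr expR; rewrite /c'; ring.
have -> : expR (- (2 * M%:R * l)) * (1 - tau) * (expR (- c * l) / 2)
    = expR (- (2 * M%:R * l)) * expR (- c * l) * ((1 - tau) / 2) by ring.
rewrite ltr_pM2l ?mulr_gt0 ?expR_gt0 // -[ltRHS]invf_div expRN.
rewrite ltf_pV2 ?posrE ?expR_gt0 ?divr_gt0 //.
rewrite -[ltLHS]lnK ?posrE ?divr_gt0 // ltr_expR.
by apply: lt_le_trans ltau; rewrite ltrDl.
Qed.
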